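(* There are effectively inseparable distributive pre-lattices that are free on countably infinitely many generators but are not computably isomorphic; that is, there exist two e.i. distributive pre-lattices $L_1,L_2$, each free on a countably infinite set of generators, such that $L_1$ and $L_2$ are not computably isomorphic.
   Context: $W_u$ denotes the $u$-th c.e. set. A c.e. bounded pre-lattice is a structure $L=\langle\omega,\wedge,\vee,0,1,\leq_L\rangle$ with $\wedge,\vee$ computable binary operations and $\leq_L$ a c.e. pre-ordering (reflexive transitive) relation, such that the equivalence relation $\equiv_L$ ($x\equiv_L y$ iff $x\leq_L y$ and $y\leq_L x$) is a congruence and the quotient $L/{\equiv_L}$, ordered by the partial order induced by $\leq_L$, is a lattice in which $\wedge$ and $\vee$ induce meet and join, with least element $[0]_L$ and greatest element $[1]_L$ (the $\equiv_L$-classes of $0$ and $1$). It is distributive if the quotient is; it is free (distributive) on a countably infinite set of generators if the quotient is a free bounded distributive lattice on a countably infinite set of generators. A disjoint pair $(A,B)$ of sets is effectively inseparable (e.i.) if there is a partial computable function $\phi(u,v)$ such that whenever $A\subseteq W_u$, $B\subseteq W_v$ and $W_u\cap W_v=\emptyset$, then $\phi(u,v)$ is defined and $\phi(u,v)\notin W_u\cup W_v$. An e.i. pre-lattice is a c.e. bounded pre-lattice $L$ such that $([0]_L,[1]_L)$ is e.i. A computable isomorphism between $L_1$ and $L_2$ is a computable function $f$ such that $x\leq_{L_1}y$ iff $f(x)\leq_{L_2}f(y)$ for all $x,y$, and $[x]_{L_1}\mapsto[f(x)]_{L_2}$ is a well-defined isomorphism of the quotient structures. *)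

(* Defs.v *)
From HB Require Import structures.
From Stdlib Require Cantor.
From mathcomp Require Import all_boot all_order.
From mathcomp Require Import boolp classical_sets.

Set Implicit Arguments.
Unset Strict Implicit.
Unset Printing Implicit Defensive.

Import Order.TTheory.

Local Open Scope classical_set_scope.
Local Open Scope quotient_scope.
Local Open Scope order_scope.

(* Programs are those of the unary presentation of the partial recursive      *)
(* functions: tuples are coded by Cantor pairing <x, y>, and the class is     *)
(* generated by 0, successor and the two projections under pairing,           *)
(* composition, primitive recursion and minimisation.                         *)

Notation pairn x y := (Cantor.to_nat (x, y)).

Local Arguments Cantor.of_nat : simpl never.
Local Arguments Cantor.to_nat : simpl never.

Inductive code : Type :=
| Zero
| Succ
| Fst
| Snd
| Pair of code & code
| Comp of code & code
| Prec of code & code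
| Mu of code.

(* [prec_graph F G a n b]: the function h with h 0 = F a and                  *)
(* h (n + 1) = G <a, <n, h n>> is defined at n with value b.                  *)
Fixpoint prec_graph (F G : nat -> nat -> Prop) (a n b : nat) : Prop :=
  if n is n'.+1 then
    exists2 b', prec_graph F G a n' b' & G (pairn a (pairn n' b')) b
  else F a b.

Fixpoint eval (c : code) (a b : nat) : Prop :=
  match c with
  | Zero => b = 0%N
  | Succ => b = a.+1
  | Fst => b = (Cantor.of_nat a).1
  | Snd => b = (Cantor.of_nat a).2
  | Pair f g => exists x y, [/\ eval f a x, eval g a y & b = pairn x y]
  | Comp f g => exists2 x, eval g a x & eval f x b
  | Prec f g =>
      prec_graph (eval f) (eval g) (Cantor.of_nat a).1 (Cantor.of_nat a).2 b
  | Mu f =>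
      eval f (pairn a b) 0%N /\
      forall m, (m < b)%N -> exists k, eval f (pairn a m) k.+1
  end.

Lemma prec_graph_inj F G a :
  (forall x y z, F x y -> F x z -> y = z) ->
  (forall x y z, G x y -> G x z -> y = z) ->
  forall n b b', prec_graph F G a n b -> prec_graph F G a n b' -> b = b'.
Proof.
move=> Finj Ginj; elim=> [|n IHn] b b' /=; first exact: Finj.
by move=> [x xn xb] [y yn]; rewrite -(IHn _ _ xn yn); apply: Ginj.
Qed.

Lemma eval_inj c a b b' : eval c a b -> eval c a b' -> b = b'.
Proof.
elim: c a b b' => [||||f IHf g IHg|f IHf g IHg|f IHf g IHg|f IHf] a b b' /=.
- by move=> -> ->.
- by move=> -> ->.
- by move=> -> ->.
- by move=> -> ->.
- move=> [x [y [fx gy ->]]] [x' [y' [fx' gy' ->]]].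
  by rewrite (IHf _ _ _ fx fx') (IHg _ _ _ gy gy').
- by move=> [x gx fx] [y gy]; rewrite -(IHg _ _ _ gx gy); apply: IHf.
- exact: prec_graph_inj.
- move=> [fb ltb] [fb' ltb'].
  case: (ltngtP b b') => // lt_bb.
  + by have [k /(IHf _ _ _ fb)] := ltb' _ lt_bb.
  + by have [k /(IHf _ _ _ fb')] := ltb _ lt_bb.
Qed.

(* Goedel numbering: an index is read as <tag, payload>, binary constructors  *)
(* having a pair of indices as payload. The first argument is fuel; an index  *)
(* with nonzero tag is greater than its payload, so fuel u suffices for u.    *)
Fixpoint decode_rec (k u : nat) : code :=
  if k is k'.+1 then
    let m := (Cantor.of_nat u).2 in
    let i := (Cantor.of_nat m).1 in
    let j := (Cantor.of_nat m).2 in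
    match (Cantor.of_nat u).1 with
    | 0 => Zero
    | 1 => Succ
    | 2 => Fst
    | 3 => Snd
    | 4 => Pair (decode_rec k' i) (decode_rec k' j)
    | 5 => Comp (decode_rec k' i) (decode_rec k' j)
    | 6 => Prec (decode_rec k' i) (decode_rec k' j)
    | _ => Mu (decode_rec k' m)
    end
  else Zero.

Definition decode (u : nat) : code := decode_rec u u.

Fixpoint encode (c : code) : nat :=
  match c with
  | Zero => pairn 0 0
  | Succ => pairn 1 0
  | Fst => pairn 2 0
  | Snd => pairn 3 0
  | Pair f g => pairn 4 (pairn (encode f) (encode g))
  | Comp f g => pairn 5 (pairn (encode f) (encode g))
  | Prec f g => pairn 6 (pairn (encode f) (encode g))
  | Mu f => pairn 7 (encode f)
  end.

Lemma leq_pairn x y : (x + y <= pairn x y)%N.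
Proof. by rewrite addnC; apply/ssrnat.leP; exact: Cantor.to_nat_non_decreasing. Qed.

Lemma decode_recK c k : (encode c <= k)%N -> decode_rec k (encode c) = c.
Proof.
have bin (t x y k' : nat) : (pairn t.+1 (pairn x y) <= k'.+1)%N ->
    (x <= k')%N /\ (y <= k')%N.
  move=> /(leq_trans (leq_pairn _ _)); rewrite addSn ltnS.
  move=> /(leq_trans (leq_addl _ _)) /(leq_trans (leq_pairn _ _)) le_xy.
  by split; apply: leq_trans le_xy; rewrite (leq_addr, leq_addl).
have un (t x k' : nat) : (pairn t.+1 x <= k'.+1)%N -> (x <= k')%N.
  move=> /(leq_trans (leq_pairn _ _)); rewrite addSn ltnS.
  exact: leq_trans (leq_addl _ _).
have pos (t x : nat) : (pairn t.+1 x <= 0)%N -> False.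
  by move=> /(leq_trans (leq_pairn _ _)).
elim: c k => [||||f IHf g IHg|f IHf g IHg|f IHf g IHg|f IHf] [|k] // le_k;
  try by case: (pos _ _ le_k).
1-3: by have [lef leg] := bin _ _ _ _ le_k;
  rewrite [LHS]/= !Cantor.cancel_of_to /= IHf ?IHg.
by rewrite [LHS]/= !Cantor.cancel_of_to /= IHf ?(un _ _ _ le_k).
Qed.

Lemma encodeK : cancel encode decode.
Proof. by move=> c; apply: decode_recK. Qed.

Definition W (u : nat) : set nat := [set x | exists y, eval (decode u) x y].

Definition computable (f : nat -> nat) : Prop :=
  exists c, forall x, eval c x (f x).

Definition computable2 (f : nat -> nat -> nat) : Prop :=
  exists c, forall x y, eval c (pairn x y) (f x y).

(* A partial function is undefined where its value is None.                   *)
Definition partial_computable2 (phi : nat -> nat -> option nat) : Prop :=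
  exists c, forall x y z, phi x y = Some z <-> eval c (pairn x y) z.

Definition ce_rel (r : nat -> nat -> Prop) : Prop :=
  exists u, forall x y, r x y <-> W u (pairn x y).

Definition effectively_inseparable (A B : set nat) : Prop :=
  A `&` B = set0 /\
  exists2 phi, partial_computable2 phi &
    forall u v, A `<=` W u -> B `<=` W v -> W u `&` W v = set0 ->
      exists2 z, phi u v = Some z & ~ (W u `|` W v) z.

(* The constants 0 and 1 of the signature are interpreted by arbitrary        *)
(* elements pzero and pone of nat.                                            *)
Record preordered_structure := PreorderedStructure {
  pmeet : nat -> nat -> nat;
  pjoin : nat -> nat -> nat;
  pzero : nat;
  pone : nat;
  ple : nat -> nat -> Prop;
  ple_refl : forall x, ple x x;
  ple_trans : forall x y z, ple x y -> ple y z -> ple x z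
}.

Definition peq (L : preordered_structure) (x y : nat) : Prop :=
  ple L x y /\ ple L y x.

Definition peqb (L : preordered_structure) : rel nat :=
  fun x y => `[< peq L x y >].

Section Quotient.
Variable L : preordered_structure.

Lemma peqb_refl : reflexive (peqb L).
Proof. by move=> x; apply/asboolP; split; apply: ple_refl. Qed.

Lemma peqb_sym : symmetric (peqb L).
Proof. by move=> x y; apply/asbool_equiv_eq; split=> -[]. Qed.

Lemma peqb_trans : transitive (peqb L).
Proof.
move=> y x z /asboolP[xy yx] /asboolP[yz zy]; apply/asboolP.
by split; [apply: ple_trans yz | apply: ple_trans yx].
Qed.

Canonical peqb_equiv : equiv_rel nat :=
  EquivRel (peqb L) peqb_refl peqb_sym peqb_trans.

Definition quot : Type := {eq_quot peqb_equiv}.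

HB.instance Definition _ := Choice.on quot.
HB.instance Definition _ := EqQuotient.on quot.

Definition class (x : nat) : quot := \pi_quot x.

Lemma classP (x y : nat) : class x = class y <-> peq L x y.
Proof.
split=> [/eqP|xy]; first by rewrite piE => /asboolP.
by apply/eqP; rewrite piE; apply/asboolP.
Qed.

Lemma peq_repr (x : nat) : peq L (repr (class x)) x.
Proof. by apply/classP; rewrite /class reprK. Qed.

Definition qle : rel quot := fun X Y => `[< ple L (repr X) (repr Y) >].

Lemma qle_refl : reflexive qle.
Proof. by move=> X; apply/asboolP; apply: ple_refl. Qed.

Lemma qle_anti : antisymmetric qle.
Proof.
move=> X Y /andP[/asboolP XY /asboolP YX].
by rewrite -[X]reprK -[Y]reprK; apply/classP.
Qed.

Lemma qle_trans : transitive qle.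
Proof.
move=> Y X Z /asboolP XY /asboolP YZ; apply/asboolP.
exact: ple_trans XY YZ.
Qed.

Fact quot_display : Order.disp_t. Proof. exact: (Order.Disp tt tt). Qed.

HB.instance Definition _ :=
  Order.Le_isPOrder.Build quot_display quot qle_refl qle_anti qle_trans.

Lemma le_class (x y : nat) : (class x <= class y) = `[< ple L x y >].
Proof.
have [xr rx] := peq_repr x; have [yr ry] := peq_repr y.
apply/asboolP/asboolP => xy.
- exact: ple_trans rx (ple_trans xy yr).
- exact: ple_trans xr (ple_trans xy ry).
Qed.

Record is_ce_bounded_prelattice : Prop := IsCEBoundedPrelattice {
  pmeet_computable : computable2 (pmeet L);
  pjoin_computable : computable2 (pjoin L);
  ple_ce : ce_rel (ple L);
  pmeet_congr : forall x x' y y',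
    peq L x x' -> peq L y y' -> peq L (pmeet L x y) (pmeet L x' y');
  pjoin_congr : forall x x' y y',
    peq L x x' -> peq L y y' -> peq L (pjoin L x y) (pjoin L x' y');
  class_meet_glb : forall (x y : nat) (Z : quot),
    (Z <= class (pmeet L x y)) = (Z <= class x) && (Z <= class y);
  class_join_lub : forall (x y : nat) (Z : quot),
    (class (pjoin L x y) <= Z) = (class x <= Z) && (class y <= Z);
  class_zero_least : forall Z : quot, class (pzero L) <= Z;
  class_one_greatest : forall Z : quot, Z <= class (pone L)
}.

End Quotient.

Record ce_bounded_prelattice := CEBoundedPrelattice {
  structure_of :> preordered_structure;
  structure_ofP : is_ce_bounded_prelattice structure_of
}.

Section QuotientLattice.
Variable L : ce_bounded_prelattice.

Definition qmeet (X Y : quot L) : quot L := class L (pmeet L (repr X) (repr Y)).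
Definition qjoin (X Y : quot L) : quot L := class L (pjoin L (repr X) (repr Y)).

Lemma qmeetP (X Y Z : quot L) : (X <= qmeet Y Z) = (X <= Y) && (X <= Z).
Proof. by rewrite (class_meet_glb (structure_ofP L)) /class !reprK. Qed.

Lemma qjoinP (X Y Z : quot L) : (qjoin X Y <= Z) = (X <= Z) && (Y <= Z).
Proof. by rewrite (class_join_lub (structure_ofP L)) /class !reprK. Qed.

HB.instance Definition _ :=
  Order.POrder_MeetJoin_isLattice.Build quot_display (quot L) qmeetP qjoinP.
HB.instance Definition _ :=
  Order.hasBottom.Build quot_display (quot L)
    (class_zero_least (structure_ofP L)).
HB.instance Definition _ :=
  Order.hasTop.Build quot_display (quot L)
    (class_one_greatest (structure_ofP L)).

Lemma class_meet (x y : nat) : class L (pmeet L x y) = class L x `&` class L y.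
Proof.
by apply/classP/(pmeet_congr (structure_ofP L)); split;
  case: (peq_repr L x) (peq_repr L y) => ? ? [].
Qed.

Lemma class_join (x y : nat) : class L (pjoin L x y) = class L x `|` class L y.
Proof.
by apply/classP/(pjoin_congr (structure_ofP L)); split;
  case: (peq_repr L x) (peq_repr L y) => ? ? [].
Qed.

Lemma class_zero : class L (pzero L) = \bot. Proof. by []. Qed.
Lemma class_one : class L (pone L) = \top. Proof. by []. Qed.

End QuotientLattice.

(* The library's {tblmorphism _ -> _} only requires preservation of \bot and  *)
(* \top, hence the explicit conjunction.                                      *)
Definition bounded_lattice_morphism d (T : tbLatticeType d)
    d' (T' : tbLatticeType d') (f : T -> T') : Prop :=
  [/\ {morph f : x y / x `&` y}, {morph f : x y / x `|` y},
      f \bot = \bot & f \top = \top].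

Definition distributive_prelattice (L : ce_bounded_prelattice) : Prop :=
  left_distributive (@Order.meet _ (quot L)) (@Order.join _ (quot L)).

Definition ei_prelattice (L : ce_bounded_prelattice) : Prop :=
  effectively_inseparable [set x | peq L x (pzero L)] [set x | peq L x (pone L)].

(* The range of the injective family g is the countably infinite set of free  *)
(* generators, free among bounded distributive lattices.                      *)
Definition free_on_countably_many (L : ce_bounded_prelattice) : Prop :=
  distributive_prelattice L /\
  exists g : nat -> quot L, injective g /\
    forall (d : Order.disp_t) (D : tbDistrLatticeType d) (h : nat -> D),
      exists! f : quot L -> D, bounded_lattice_morphism f /\ f \o g = h.

Definition computably_isomorphic (L1 L2 : ce_bounded_prelattice) : Prop :=
  exists f : nat -> nat,
    [/\ computable f,
        forall x y, ple L1 x y <-> ple L2 (f x) (f y) &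
        exists F : quot L1 -> quot L2,
          [/\ forall x, F (class L1 x) = class L2 (f x),
              bijective F & bounded_lattice_morphism F]].

(* Main.v *)
From HB Require Import structures.
From Stdlib Require Cantor.
From mathcomp Require Import all_boot all_order.
From mathcomp Require Import boolp classical_sets functions cardinality.
From mathcomp Require Import zify.
Require Import Defs.

Set Implicit Arguments.
Unset Strict Implicit.
Unset Printing Implicit Defensive.

Import Order.TTheory.

Local Arguments Cantor.of_nat : simpl never.
Local Arguments Cantor.to_nat : simpl never.
Local Opaque Cantor.of_nat Cantor.to_nat.

(** The lattice [L c = prelattice (race_naming c)], for a boolean [c], is
    presented by variables indexed by numbers [<p, z>]; its elements are the
    codes of terms in these variables, and the order is entailment between terms
    under the truth assignments that
    respect the following conventions. Let [(raceA, raceB)] be the effectively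
    inseparable pair given by the race, for [z = <u, v>], between [z] entering
    [W u] and [z] entering [W v]. The variable [<0, z>] is false if [z] is in
    [raceA], true if [z] is in [raceB], and a generator otherwise; [<2, z>] is
    false and [<3, z>] is true; and if [c] holds, the variables [<1, z>] with [z]
    in [raceA] are all identified. The other variables are distinct generators.

    Entailment is c.e. ([ce_entails]), because at each finite stage of the
    enumerations it can be tested on the assignments of finitely many variables.
    Every lattice [L c] is effectively inseparable, by the map sending [z] to the
    variable [<0, z>] ([prelattice_ei]). It is free ([prelattice_free]), because
    entailment of terms under truth assignments implies inequality of their
    values in every bounded distributive lattice ([entails_ti]); this follows
    from the Shannon expansion of a monotone term [t] along a variable [x],
    [t = t[x:=0] \/ (x /\ t[x:=1])].

    The lattices [L true] and [L false] are told apart by computable sequences of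
    generators. In [L true] the variables [<1, z>] form a sequence of generators
    in which one generator occurs exactly at the positions in [raceA], a set
    whose complement is not c.e. An isomorphism onto [L false] would send it to a
    computable sequence of terms. These are irreducible, hence equivalent to
    variables ([irreducible_var]). A generator of [L false] is, however, the
    class of a single variable [k]; and a term equivalent to a variable that is
    not [k] can be recognised effectively, because its independence of [k] is
    again an entailment ([ce_independent]). So the positions at which a given
    generator does not occur would form a c.e. set. *)

(** * Closure properties of the computable functions *)

Local Notation fstn x := (Cantor.of_nat x).1.
Local Notation sndn x := (Cantor.of_nat x).2.

Lemma pairnK x y : Cantor.of_nat (pairn x y) = (x, y).
Proof. exact: Cantor.cancel_of_to. Qed.

Lemma fstn_pair x y : fstn (pairn x y) = x. Proof. by rewrite pairnK. Qed.
Lemma sndn_pair x y : sndn (pairn x y) = y. Proof. by rewrite pairnK. Qed.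

Definition unpairE := (fstn_pair, sndn_pair).

Lemma unpairnK x : pairn (fstn x) (sndn x) = x.
Proof. by rewrite -[RHS]Cantor.cancel_to_of; case: (Cantor.of_nat x). Qed.

Lemma sndn_lt x : 0 < fstn x -> sndn x < x.
Proof. by have := leq_pairn (fstn x) (sndn x); rewrite unpairnK; lia. Qed.

Lemma sndn_le x : sndn x <= x.
Proof. by have := leq_pairn (fstn x) (sndn x); rewrite unpairnK; lia. Qed.

Lemma fstn_le x : fstn x <= x.
Proof. by have := leq_pairn (fstn x) (sndn x); rewrite unpairnK; lia. Qed.

Lemma computable_id : computable (fun x => x).
Proof.
exists (Pair Fst Snd) => x; exists (fstn x), (sndn x); split=> //.
by rewrite unpairnK.
Qed.

Lemma computable_comp f g :
  computable f -> computable g -> computable (fun x => f (g x)).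
Proof. by move=> [c cP] [d dP]; exists (Comp c d) => x; exists (g x). Qed.

Lemma computable_succ f : computable f -> computable (fun x => (f x).+1).
Proof. by apply: computable_comp; exists Succ. Qed.

Lemma computable_const n : computable (fun=> n).
Proof. by elim: n => [|n /computable_succ //]; exists Zero. Qed.

Lemma computable_fst f : computable f -> computable (fun x => fstn (f x)).
Proof. by apply: (@computable_comp (fun x => fstn x)); exists Fst. Qed.

Lemma computable_snd f : computable f -> computable (fun x => sndn (f x)).
Proof. by apply: (@computable_comp (fun x => sndn x)); exists Snd. Qed.

Lemma computable_pair f g :
  computable f -> computable g -> computable (fun x => pairn (f x) (g x)).
Proof.
by move=> [c cP] [d dP]; exists (Pair c d) => x; exists (f x), (g x).
Qed.

(** A two-place function that is computable in the coded pair of its arguments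
    can be applied to computable arguments. *)
Lemma computable_app2 (P : nat -> nat -> nat) f g :
    computable (fun y => P (fstn y) (sndn y)) -> computable f -> computable g ->
  computable (fun x => P (f x) (g x)).
Proof.
move=> cP cf cg.
have [c cE] := computable_comp cP (computable_pair cf cg).
by exists c => x; have := cE x; rewrite !unpairE.
Qed.

Lemma computable_iteri (f m : nat -> nat) (g : nat -> nat -> nat -> nat) :
    computable f ->
    computable (fun y => g (fstn y) (fstn (sndn y)) (sndn (sndn y))) ->
    computable m ->
  computable (fun x => iteri (m x) (g x) (f x)).
Proof.
move=> [cf cfP] [cg cgP] [cm cmP]; have [ci ciP] := computable_id.
exists (Comp (Prec cf cg) (Pair ci cm)) => x.
exists (pairn x (m x)); first by exists x, (m x).
rewrite /= pairnK /=; elim: (m x) => [|n IHn] /=; first exact: cfP.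
exists (iteri n (g x) (f x)) => //.
by have := cgP (pairn x (pairn n (iteri n (g x) (f x)))); rewrite !unpairE.
Qed.

Lemma computable_iter (f m : nat -> nat) (g : nat -> nat -> nat) :
    computable f -> computable (fun y => g (fstn y) (sndn (sndn y))) ->
    computable m ->
  computable (fun x => iter (m x) (g x) (f x)).
Proof.
move=> cf cg cm.
exact: (@computable_iteri f m (fun x _ => g x)).
Qed.

(** Case distinction on whether [n] vanishes; it also serves as conjunction and
    disjunction of truth values, every nonzero number standing for truth. *)
Definition ifz (n b c : nat) : nat := if n is 0 then b else c.

Lemma computable_ifz f g h : computable f -> computable g -> computable h ->
  computable (fun x => ifz (f x) (g x) (h x)).
Proof.
move=> cf cg ch.
have -> : (fun x => ifz (f x) (g x) (h x)) =
          (fun x => iteri (f x) (fun _ _ => h x) (g x)).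
  by apply: funext => x; case: (f x).
by apply: (@computable_iteri g f (fun x _ _ => h x)) => //;
  apply: (computable_comp ch); apply: computable_fst computable_id.
Qed.

Lemma computable_pred f : computable f -> computable (fun x => (f x).-1).
Proof.
move=> cf.
have -> : (fun x => (f x).-1) = (fun x => iteri (f x) (fun i _ => i) 0).
  by apply: funext => x; case: (f x).
apply: (@computable_iteri (fun=> 0) f (fun _ i _ => i)) => //.
  exact: computable_const.
exact: computable_fst (computable_snd computable_id).
Qed.

Lemma computable_add f g :
  computable f -> computable g -> computable (fun x => f x + g x).
Proof.
move=> cf cg.
have -> : (fun x => f x + g x) = (fun x => iter (g x) succn (f x)).
  by apply: funext => x; rewrite iter_succn addnC.
apply: (@computable_iter f g (fun _ => succn)) => //.
exact: computable_succ (computable_snd (computable_snd computable_id)).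
Qed.

Lemma computable_sub f g :
  computable f -> computable g -> computable (fun x => f x - g x).
Proof.
move=> cf cg.
have -> : (fun x => f x - g x) = (fun x => iter (g x) predn (f x)).
  by apply: funext => x; rewrite iter_predn.
apply: (@computable_iter f g (fun _ => predn)) => //.
exact: computable_pred (computable_snd (computable_snd computable_id)).
Qed.

(** Vanishes exactly when the arguments are equal. *)
Definition distn (m n : nat) : nat := (m - n) + (n - m).

Lemma distn_eq0 m n : (distn m n == 0) = (m == n).
Proof. by rewrite /distn; lia. Qed.

Lemma ifz_eq m n b c : ifz (distn m n) b c = if m == n then b else c.
Proof. by rewrite -distn_eq0; case: (distn m n). Qed.

Lemma computable_dist f g :
  computable f -> computable g -> computable (fun x => distn (f x) (g x)).
Proof. by move=> cf cg; apply: computable_add; apply: computable_sub. Qed.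

(** Proves the computability of expressions built from the functions above. *)
Ltac comp := repeat (cbv beta zeta; first
  [ assumption | apply: computable_const | apply: computable_id
  | apply: computable_pair | apply: computable_fst | apply: computable_snd
  | apply: computable_succ | apply: computable_pred
  | apply: computable_ifz | apply: computable_dist
  | apply: computable_add | apply: computable_sub ]).

(** Search through all [i < n]: vanishes when [P i] does for every [i < n]. *)
Definition bforall (n : nat) (P : nat -> nat) : nat :=
  iteri n (fun i acc => ifz (P i) acc 1) 0.

Lemma bforallP n P : reflect (forall i, i < n -> P i = 0) (bforall n P == 0).
Proof.
apply: (iffP eqP); elim: n => [|n IHn] //.
  rewrite /bforall /= -/(bforall n P); case Pn: (P n) => //= /IHn Plt i.
  by rewrite ltnS leq_eqVlt => /predU1P[->|/Plt].
move=> Plt; rewrite /bforall /= -/(bforall n P) Plt //=.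
by apply: IHn => i /ltnW/Plt.
Qed.

Lemma computable_bforall (m : nat -> nat) (P : nat -> nat -> nat) :
  computable m -> computable (fun y => P (fstn y) (sndn y)) ->
  computable (fun x => bforall (m x) (P x)).
Proof.
move=> cm cP.
apply: (@computable_iteri (fun=> 0) m (fun x i acc => ifz (P x i) acc 1)); comp.
by apply: (computable_app2 cP); comp.
Qed.

(** ** Course-of-values recursion *)

(** The table [<f (n - 1), <..., <f 0, 0>>>] of the function [f] defined by
    [f n = s n (table n)]. *)
Definition table (s : nat -> nat -> nat) (n : nat) : nat :=
  iteri n (fun i T => pairn (s i T) T) 0.

(** The entry [i < n] of a table [T] of length [n]. *)
Definition lookup (T n i : nat) : nat :=
  fstn (iter (n.-1 - i) (fun T => sndn T) T).

Lemma lookup_table s n i : i < n -> lookup (table s n) n i = s i (table s i).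
Proof.
elim: n => // n IHn; rewrite ltnS leq_eqVlt => /predU1P[->|lt_in].
  by rewrite /lookup /= subnn /= unpairE.
rewrite -(IHn lt_in) /lookup.
have -> : n.+1.-1 - i = (n.-1 - i).+1 by lia.
by rewrite iterSr /table /= unpairE.
Qed.

Lemma computable_lookup T n i : computable T -> computable n -> computable i ->
  computable (fun x => lookup (T x) (n x) (i x)).
Proof.
move=> cT cn ci; apply: computable_fst.
apply: (@computable_iter T _ (fun _ T => sndn T)); comp.
Qed.

Lemma computable_table (s : nat -> nat -> nat -> nat) n :
  computable (fun y => s (fstn y) (fstn (sndn y)) (sndn (sndn y))) ->
  computable n -> computable (fun x => table (s x) (n x)).
Proof.
move=> cs cn.
apply: (@computable_iteri (fun=> 0) n (fun x i T => pairn (s x i T) T)); comp.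
Qed.

(** ** Computably enumerable sets *)

Lemma W_encode c : W (encode c) = [set x | exists y, eval c x y]%classic.
Proof. by rewrite /W encodeK. Qed.

(** A projection of a decidable relation is c.e. *)
Lemma ce_projection (P : nat -> nat -> nat) :
  computable (fun y => P (fstn y) (sndn y)) ->
  exists u, forall x, W u x <-> exists n, P x n = 0.
Proof.
move=> [c cP]; exists (encode (Mu c)) => x; rewrite W_encode /=.
have evP m : eval c (pairn x m) (P x m) by have := cP (pairn x m); rewrite !unpairE.
split=> [[n [n0 _]]|[n n0]]; first by exists n; apply: eval_inj (evP n) n0.
have exP : exists n, P x n == 0 by exists n; apply/eqP.
case: (ex_minnP exP) => m /eqP m0 minm; exists m; split; first by rewrite -m0.
move=> k lt_km; case Pk: (P x k) (evP k) => [|j]; last by exists j.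
by have := minm k; rewrite Pk eqxx leqNgt lt_km => /(_ isT).
Qed.

Lemma ce_preimage u f : computable f -> exists v, forall x, W v x <-> W u (f x).
Proof.
move=> [c cP]; exists (encode (Comp (decode u) c)) => x.
rewrite W_encode /W /=; split=> [[y [z cz dy]]|[y dy]].
  by exists y; rewrite (eval_inj (cP x) cz).
by exists y, (f x).
Qed.

(** * A universal machine *)

Lemma decode_recE k u : u <= k -> decode_rec k u = decode u.
Proof.
rewrite /decode; elim/ltn_ind: u k => -[|u] IHu [|k] le_uk //.
have lt_sub : 0 < fstn u.+1 ->
    [/\ sndn u.+1 <= u, fstn (sndn u.+1) <= u & sndn (sndn u.+1) <= u].
  move=> /sndn_lt; have := fstn_le (sndn u.+1); have := sndn_le (sndn u.+1).
  by split; lia.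
have fuelE j : j <= u -> decode_rec k j = decode_rec u j.
  by move=> le_ju; rewrite !(IHu j) //; lia.
rewrite [LHS]/= [RHS]/=.
case: (fstn u.+1) lt_sub => // t [] // leu le1 le2.
by case: t => [|[|[|[|[|[|t]]]]]] //; rewrite !fuelE.
Qed.

Lemma decodeE u : decode u =
  match fstn u with
  | 0 => Zero
  | 1 => Succ
  | 2 => Fst
  | 3 => Snd
  | 4 => Pair (decode (fstn (sndn u))) (decode (sndn (sndn u)))
  | 5 => Comp (decode (fstn (sndn u))) (decode (sndn (sndn u)))
  | 6 => Prec (decode (fstn (sndn u))) (decode (sndn (sndn u)))
  | _ => Mu (decode (sndn u))
  end.
Proof.
rewrite -[LHS](@decode_recE u.+1) //= .
have lt_sub : [/\ sndn u <= u, fstn (sndn u) <= u & sndn (sndn u) <= u].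
  have := fstn_le (sndn u); have := sndn_le (sndn u); have := sndn_le u.
  by split; lia.
case: lt_sub => leu le1 le2.
by case: (fstn u) => [|[|[|[|[|[|[|t]]]]]]] //; rewrite !decode_recE.
Qed.

(** Configurations of a stack machine: [Ev u a k] is about to evaluate the
    program with index [u] at [a], and [Rt b k] returns the value [b], to the
    stack [k] of pending frames. The empty stack is [0], and any number whose
    first component is [0] is read as such; a frame [<t, d>] on top of [k] is
    coded by [<t, <d, k>>], with [t > 0]. *)
Definition Ev u a k := pairn 0 (pairn u (pairn a k)).
Definition Rt b k := pairn 1 (pairn b k).
Definition push t d k := pairn t (pairn d k).

Definition step_eval (u a k : nat) : nat :=
  let t := fstn u in
  let m := sndn u in
  let i := fstn m in
  let j := sndn m in
  ifz t (Rt 0 k)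
  (ifz (t - 1) (Rt a.+1 k)
  (ifz (t - 2) (Rt (fstn a) k)
  (ifz (t - 3) (Rt (sndn a) k)
  (ifz (t - 4) (Ev i a (push 1 (pairn j a) k))
  (ifz (t - 5) (Ev j a (push 2 i k))
  (ifz (t - 6)
     (Ev i (fstn a) (push 4 (pairn j (pairn (fstn a) (pairn 0 (sndn a)))) k))
     (Ev m (pairn a 0) (push 5 (pairn m (pairn a 0)) k)))))))).

(** The frames are, in order: evaluate the second component of a pair; apply the
    outer program of a composition; pair with the first component; perform the
    remaining [m] rounds of a recursion that has done [n]; continue a
    minimisation that has reached [n]. *)
Definition step_return (b s : nat) : nat :=
  let t := fstn s in
  let d := fstn (sndn s) in
  let k := sndn (sndn s) in
  ifz t (Rt b s)
  (ifz (t - 1) (Ev (fstn d) (sndn d) (push 3 b k))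
  (ifz (t - 2) (Ev d b k)
  (ifz (t - 3) (Rt (pairn d b) k)
  (ifz (t - 4)
    (let j := fstn d in
     let a := fstn (sndn d) in
     let n := fstn (sndn (sndn d)) in
     let m := sndn (sndn (sndn d)) in
     ifz m (Rt b k)
       (Ev j (pairn a (pairn n b))
         (push 4 (pairn j (pairn a (pairn n.+1 m.-1))) k)))
    (let f := fstn d in
     let a := fstn (sndn d) in
     let n := sndn (sndn d) in
     ifz b (Rt n k) (Ev f (pairn a n.+1) (push 5 (pairn f (pairn a n.+1)) k))))))).

Definition step (s : nat) : nat :=
  ifz (fstn s)
    (step_eval (fstn (sndn s)) (fstn (sndn (sndn s))) (sndn (sndn (sndn s))))
    (step_return (fstn (sndn s)) (sndn (sndn s))).

Lemma computable_step : computable step.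
Proof.
rewrite /step /step_eval /step_return /Ev /Rt /push; comp.
Qed.

Lemma step_Ev u a k : step (Ev u a k) =
  match fstn u with
  | 0 => Rt 0 k
  | 1 => Rt a.+1 k
  | 2 => Rt (fstn a) k
  | 3 => Rt (sndn a) k
  | 4 => Ev (fstn (sndn u)) a (push 1 (pairn (sndn (sndn u)) a) k)
  | 5 => Ev (sndn (sndn u)) a (push 2 (fstn (sndn u)) k)
  | 6 => Ev (fstn (sndn u)) (fstn a)
           (push 4 (pairn (sndn (sndn u)) (pairn (fstn a) (pairn 0 (sndn a)))) k)
  | _ => Ev (sndn u) (pairn a 0) (push 5 (pairn (sndn u) (pairn a 0)) k)
  end.
Proof.
rewrite /step /step_eval {1 2 3 4}/Ev !unpairE /=.
by case: (fstn u) => [|[|[|[|[|[|[|t]]]]]]].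
Qed.

Lemma step_Rt_pair1 b j a k :
  step (Rt b (push 1 (pairn j a) k)) = Ev j a (push 3 b k).
Proof. by rewrite /step /step_return /Rt /push !unpairE /= ?unpairE. Qed.

Lemma step_Rt_comp b i k : step (Rt b (push 2 i k)) = Ev i b k.
Proof. by rewrite /step /step_return /Rt /push !unpairE /= ?unpairE. Qed.

Lemma step_Rt_pair2 b x k : step (Rt b (push 3 x k)) = Rt (pairn x b) k.
Proof. by rewrite /step /step_return /Rt /push !unpairE /= ?unpairE. Qed.

Lemma step_Rt_prec b j a n m k :
  step (Rt b (push 4 (pairn j (pairn a (pairn n m))) k)) =
  if m is m'.+1 then
    Ev j (pairn a (pairn n b)) (push 4 (pairn j (pairn a (pairn n.+1 m'))) k)
  else Rt b k.
Proof. by rewrite /step /step_return /Rt /push !unpairE /= ?unpairE; case: m. Qed.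

Lemma step_Rt_mu b f a n k :
  step (Rt b (push 5 (pairn f (pairn a n)) k)) =
  if b is 0 then Rt n k
  else Ev f (pairn a n.+1) (push 5 (pairn f (pairn a n.+1)) k).
Proof. by rewrite /step /step_return /Rt /push !unpairE /= ?unpairE; case: b. Qed.

(** [run s s']: the machine leads from [s] to [s']. *)
Definition run (s s' : nat) : Prop := exists n, iter n step s = s'.

Lemma run_trans s s' s'' : run s s' -> run s' s'' -> run s s''.
Proof. by move=> [n <-] [m <-]; exists (m + n); rewrite iterD. Qed.

Lemma run_refl s : run s s. Proof. by exists 0. Qed.

Lemma run_step s s' : run (step s) s' -> run s s'.
Proof. by move=> [n <-]; exists n.+1; rewrite iterSr. Qed.

Lemma eval_run u a b k : eval (decode u) a b -> run (Ev u a k) (Rt b k).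
Proof.
elim/ltn_ind: u a b k => u IHu a b k.
have lt_sub : 0 < fstn u ->
    [/\ sndn u < u, fstn (sndn u) < u & sndn (sndn u) < u].
  move=> /sndn_lt; have := fstn_le (sndn u); have := sndn_le (sndn u).
  by split; lia.
rewrite decodeE => ev_u; apply: run_step; rewrite step_Ev.
case: (fstn u) lt_sub ev_u => [|t] lt_sub ev_u.
  by rewrite ev_u; apply: run_refl.
have {lt_sub}[//|lt_m lt_i lt_j] := lt_sub.
case: t ev_u => [|[|[|[|[|[|t]]]]]] /=.
- by move=> ->; apply: run_refl.
- by move=> ->; apply: run_refl.
- by move=> ->; apply: run_refl.
- move=> [x [y [ev_x ev_y ->]]].
  apply: run_trans (IHu _ lt_i _ _ _ ev_x) _.
  apply: run_step; rewrite step_Rt_pair1.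
  apply: run_trans (IHu _ lt_j _ _ _ ev_y) _.
  by apply: run_step; rewrite step_Rt_pair2; apply: run_refl.
- move=> [x ev_x ev_b].
  apply: run_trans (IHu _ lt_j _ _ _ ev_x) _.
  by apply: run_step; rewrite step_Rt_comp; apply: IHu.
- set F := eval _; set G := eval _.
  (* The invariant of the loop: n rounds lead to the n-th value. *)
  have loop n m c : prec_graph F G (fstn a) n c ->
      run (Ev (fstn (sndn u)) (fstn a)
             (push 4 (pairn (sndn (sndn u)) (pairn (fstn a) (pairn 0 (n + m)))) k))
          (Rt c
             (push 4 (pairn (sndn (sndn u)) (pairn (fstn a) (pairn n m))) k)).
    elim: n m c => [|n IHn] m c /=; first exact: IHu.
    move=> [c' /(IHn m.+1) run_c' ev_c]; rewrite addSnnS.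
    apply: run_trans run_c' _; apply: run_step; rewrite step_Rt_prec.
    exact: IHu.
  move=> /(loop _ 0); rewrite addn0 => run_b; apply: run_trans run_b _.
  by apply: run_step; rewrite step_Rt_prec; apply: run_refl.
- move=> [ev_b ev_lt].
  have loop n : n <= b ->
      run (Ev (sndn u) (pairn a 0) (push 5 (pairn (sndn u) (pairn a 0)) k))
          (Ev (sndn u) (pairn a n) (push 5 (pairn (sndn u) (pairn a n)) k)).
    elim: n => [|n IHn] le_nb; first exact: run_refl.
    apply: run_trans (IHn (ltnW le_nb)) _.
    have [c ev_c] := ev_lt _ le_nb.
    apply: run_trans (IHu _ lt_m _ _ _ ev_c) _.
    by apply: run_step; rewrite step_Rt_mu; apply: run_refl.
  apply: run_trans (loop _ (leqnn b)) _.
  apply: run_trans (IHu _ lt_m _ _ _ ev_b) _.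
  by apply: run_step; rewrite step_Rt_mu; apply: run_refl.
Qed.

(** Vanishes at the configurations that return to the empty stack. *)
Definition running (s : nat) : nat := ifz (fstn s) 1 (fstn (sndn (sndn s))).

(** The machine started at [s] has stopped after [n] steps. *)
Definition halts_in (n s : nat) : Prop := running (iter n step s) = 0.

Lemma running_Ev u a k : running (Ev u a k) = 1.
Proof. by rewrite /running unpairE. Qed.

Lemma running_Rt b k : running (Rt b k) = fstn k.
Proof. by rewrite /running !unpairE. Qed.

Lemma halts_in_step n s :
  running s != 0 -> halts_in n s -> exists2 m, m < n & halts_in m (step s).
Proof.
move=> run_s; case: n => [/eqP|n]; first by rewrite (negPf run_s).
by rewrite /halts_in iterSr => ?; exists n.
Qed.

(** A computation that halts starts by completing the evaluation on top of the
    stack, whose program is therefore defined at its argument. *)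
Lemma halts_in_Ev n u a k : halts_in n (Ev u a k) ->
  exists b, eval (decode u) a b /\ exists2 m, m < n & halts_in m (Rt b k).
Proof.
elim/ltn_ind: u n a k => u IHu n a k.
have lt_sub : 0 < fstn u ->
    [/\ sndn u < u, fstn (sndn u) < u & sndn (sndn u) < u].
  move=> /sndn_lt; have := fstn_le (sndn u); have := sndn_le (sndn u).
  by split; lia.
move=> /halts_in_step; rewrite running_Ev step_Ev decodeE => -[//|n' lt_n'].
case: (fstn u) lt_sub => [|t] lt_sub.
  by exists 0; split=> //; exists n'.
have {lt_sub}[//|lt_m lt_i lt_j] := lt_sub.
case: t => [|[|[|[|[|[|t]]]]]] /=.
- by exists a.+1; split=> //; exists n'.
- by exists (fstn a); split=> //; exists n'.
- by exists (sndn a); split=> //; exists n'.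
- move=> /(IHu _ lt_i)[x [ev_x [n1 lt_n1]]].
  move=> /halts_in_step; rewrite running_Rt step_Rt_pair1 fstn_pair => -[//|n2 lt_n2].
  move=> /(IHu _ lt_j)[y [ev_y [n3 lt_n3]]].
  move=> /halts_in_step; rewrite running_Rt step_Rt_pair2 fstn_pair => -[//|n4 lt_n4].
  move=> halt; exists (pairn x y); split; first by exists x, y.
  by exists n4 => //; lia.
- move=> /(IHu _ lt_j)[x [ev_x [n1 lt_n1]]].
  move=> /halts_in_step; rewrite running_Rt step_Rt_comp fstn_pair => -[//|n2 lt_n2].
  move=> /(IHu _ lt_i)[y [ev_y [n3 lt_n3 halt]]].
  by exists y; split; [exists x | exists n3 => //; lia].
- set F := eval _; set G := eval _.
  have loop m i n0 c : prec_graph F G (fstn a) i c ->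
      halts_in n0 (Rt c
        (push 4 (pairn (sndn (sndn u)) (pairn (fstn a) (pairn i m))) k)) ->
      exists b, prec_graph F G (fstn a) (i + m) b /\
        exists2 n1, n1 < n0 & halts_in n1 (Rt b k).
    elim: m i n0 c => [|m IHm] i n0 c prec_c /halts_in_step;
      rewrite running_Rt step_Rt_prec fstn_pair => -[//|n1 lt_n1].
      by move=> halt; exists c; rewrite addn0; split=> //; exists n1.
    move=> /(IHu _ lt_j)[d [ev_d [n2 lt_n2]]] /IHm[|b [prec_b [n3 lt_n3 halt]]].
      by exists c.
    by exists b; rewrite addnS; split=> //; exists n3 => //; lia.
  move=> /(IHu _ lt_i)[x [ev_x [n1 lt_n1]]] /loop[//|b [prec_b [n2 lt_n2 halt]]].
  by exists b; split=> //; exists n2 => //; lia.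
- have loop n0 i :
      (forall j, j < i -> exists c, eval (decode (sndn u)) (pairn a j) c.+1) ->
      halts_in n0
        (Ev (sndn u) (pairn a i) (push 5 (pairn (sndn u) (pairn a i)) k)) ->
      exists b, eval (Mu (decode (sndn u))) a b /\
        exists2 n1, n1 < n0 & halts_in n1 (Rt b k).
    elim/ltn_ind: n0 i => n0 IHn i ev_lt.
    move=> /(IHu _ lt_m)[c [ev_c [n1 lt_n1]]].
    move=> /halts_in_step; rewrite running_Rt step_Rt_mu fstn_pair => -[//|n2 lt_n2].
    case: c ev_c => [|c] ev_c halt.
      by exists i; split=> //; exists n2 => //; lia.
    case: (IHn n2 _ i.+1 _ halt) => [|j|b [ev_b [n3 lt_n3 halt3]]]; first by lia.
      by rewrite ltnS leq_eqVlt => /predU1P[->|/ev_lt //]; exists c.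
    by exists b; split=> //; exists n3 => //; lia.
  move=> /loop[//|b [ev_b [n1 lt_n1 halt]]].
  by exists b; split=> //; exists n1 => //; lia.
Qed.

Lemma W_halts u a : W u a <-> exists n, halts_in n (Ev u a 0).
Proof.
split=> [[b /(@eval_run _ _ _ 0)[n run_n]]|[n /halts_in_Ev[b [ev_b _]]]].
  by exists n; rewrite /halts_in run_n running_Rt.
by exists b.
Qed.

(** * An effectively inseparable pair *)

(** The pair [<u, v>] takes part in a race between its membership in [W u] and
    its membership in [W v]. At stage [n] the outcome is [0] if neither has been
    observed, [1] if the second one was observed first (or simultaneously), and
    [2] if the first one was observed first. *)
Definition race (z n : nat) : nat :=
  iteri n (fun i st => ifz st
    (ifz (running (iter i step (Ev (sndn z) z 0))) 1
      (ifz (running (iter i step (Ev (fstn z) z 0))) 2 0))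
    st) 0.

Lemma computable_race : computable (fun y => race (fstn y) (sndn y)).
Proof.
apply: (@computable_iteri (fun=> 0) (fun y => sndn y) (fun y i st => ifz st
    (ifz (running (iter i step (Ev (sndn (fstn y)) (fstn y) 0))) 1
      (ifz (running (iter i step (Ev (fstn (fstn y)) (fstn y) 0))) 2 0))
    st)); [comp | | comp].
have cstep m s : computable m -> computable s ->
    computable (fun y => running (iter (m y) step (s y))).
  move=> cm cs.
  have ci : computable (fun y => iter (m y) step (s y)).
    apply: (@computable_iter s m (fun _ => step)) => //.
    by apply: (computable_comp computable_step); comp.
  by rewrite /running; comp.
by repeat (apply: cstep || apply: computable_ifz); rewrite /Ev; comp.
Qed.

Lemma race_stable z n m : race z n != 0 -> n <= m -> race z m = race z n.
Proof.
move=> nz; elim: m => [|m IHm]; first by rewrite leqn0 => /eqP ->.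
rewrite leq_eqVlt => /predU1P[-> //|/IHm rm].
by move: nz; rewrite -rm /race /= -/(race z m); case: (race z m).
Qed.

Lemma race_outcome z n :
  [\/ race z n = 0, race z n = 1 /\ W (sndn z) z | race z n = 2 /\ W (fstn z) z].
Proof.
elim: n => [|n IHn]; first by constructor 1.
have raceS : race z n.+1 = ifz (race z n)
    (ifz (running (iter n step (Ev (sndn z) z 0))) 1
      (ifz (running (iter n step (Ev (fstn z) z 0))) 2 0)) (race z n) by [].
rewrite raceS; case: IHn => [->|[-> Wz]|[-> Wz]] /=; last 2 first.
- by constructor 2.
- by constructor 3.
case h2: (running _) => [|k].
  by constructor 2; split=> //; apply/W_halts; exists n.
case h1: (running _) => [|k']; last by constructor 1.
by constructor 3; split=> //; apply/W_halts; exists n.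
Qed.

Lemma race_decided z : W (fstn z) z \/ W (sndn z) z -> exists n, race z n != 0.
Proof.
move=> Wz; have [n halt_n] : exists n, halts_in n (Ev (fstn z) z 0) \/
    halts_in n (Ev (sndn z) z 0).
  by case: Wz => /W_halts[n ?]; exists n; [left | right].
exists n.+1; rewrite /race /= -/(race z n); case: (race z n) => //=.
by case: halt_n => ->; first case: (running _).
Qed.

(** The effectively inseparable pair: [<u, v>] is in [raceA] if it is observed in
    [W v] first, and in [raceB] if it is observed in [W u] first. *)
Definition raceA (z : nat) : Prop := exists n, race z n = 1.
Definition raceB (z : nat) : Prop := exists n, race z n = 2.

Lemma raceAB z : raceA z -> raceB z -> False.
Proof.
move=> [n rn] [m rm].
have := @race_stable z n (maxn n m); have := @race_stable z m (maxn n m).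
by rewrite rn rm leq_maxl leq_maxr => -> // /(_ isT isT).
Qed.

Lemma ce_raceA : exists u, forall z, W u z <-> raceA z.
Proof.
have [|u uP] := @ce_projection (fun z n => distn (race z n) 1).
  by have := computable_race => ?; comp.
exists u => z; rewrite uP; split=> -[n rn]; exists n; last by rewrite rn.
by apply/eqP; rewrite -distn_eq0 rn.
Qed.

(** Pairing is a productive function: if [<u, v>] is first observed in [W u] then
    it belongs to [raceB], hence to [W v] as well, against disjointness; and
    likewise if it is first observed in [W v]. *)
Lemma race_ei u v :
    (forall z, raceA z -> W u z) -> (forall z, raceB z -> W v z) ->
    (forall z, W u z -> W v z -> False) ->
  ~ (W u (pairn u v) \/ W v (pairn u v)).
Proof.
move=> sAu sBv Wuv0 Wz; set z := pairn u v in Wz.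
have [n] : exists n, race z n != 0 by apply: race_decided; rewrite !unpairE.
case: (race_outcome z n) => [->//|[rn]|[rn]] Wz'; rewrite !unpairE in Wz' => _.
- by apply: Wuv0 Wz'; apply: sAu; exists n.
- by apply: Wuv0 Wz' _; apply: sBv; exists n.
Qed.

Lemma raceA_not_coce v : (forall z, W v z <-> ~ raceA z) -> False.
Proof.
move=> vP; have [u uP] := ce_raceA.
case: (@race_ei u v) => [z /uP //|z Bz|z /uP Az /vP //|].
  by apply/vP => /raceAB /(_ Bz).
by case: (pselect (raceA (pairn u v))) => Az; [left; apply/uP | right; apply/vP].
Qed.

(** * Terms *)

(** Terms are built from variables with meets and joins. Elements of the lattices
    are codes of terms; every number is the code of a term. *)
Inductive term := Var of nat | Meet of term & term | Join of term & term.

(** Decoding; the first argument is fuel, of which [t.+1] suffices for [t], and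
    every tag above [1] denotes a join. *)
Fixpoint dec_rec (k t : nat) : term :=
  if k is k'.+1 then
    let x := dec_rec k' (fstn (sndn t)) in
    let y := dec_rec k' (sndn (sndn t)) in
    match fstn t with
    | 0 => Var (sndn t)
    | 1 => Meet x y
    | _ => Join x y
    end
  else Var 0.

Definition dec (t : nat) : term := dec_rec t.+1 t.

Fixpoint enc (t : term) : nat :=
  match t with
  | Var i => pairn 0 i
  | Meet x y => pairn 1 (pairn (enc x) (enc y))
  | Join x y => pairn 2 (pairn (enc x) (enc y))
  end.

Lemma subcode_lt t : 0 < fstn t -> fstn (sndn t) < t /\ sndn (sndn t) < t.
Proof.
move=> /sndn_lt; have := fstn_le (sndn t); have := sndn_le (sndn t).
by split; lia.
Qed.

Lemma dec_recE k t : t < k -> dec_rec k t = dec t.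
Proof.
rewrite /dec; elim/ltn_ind: t k => t IHt [|k] // lt_tk.
rewrite [LHS]/= [RHS]/=.
case: (fstn t) (@subcode_lt t) => // i [] // lt1 lt2.
have fuelE j : j < t -> dec_rec k j = dec_rec t j.
  by move=> lt_jt; rewrite !(IHt j) //; lia.
by rewrite !fuelE.
Qed.

Lemma decE t : dec t =
  match fstn t with
  | 0 => Var (sndn t)
  | 1 => Meet (dec (fstn (sndn t))) (dec (sndn (sndn t)))
  | _ => Join (dec (fstn (sndn t))) (dec (sndn (sndn t)))
  end.
Proof.
rewrite {1}/dec /=; case: (fstn t) (@subcode_lt t) => // i [] // lt1 lt2.
by rewrite !dec_recE.
Qed.

Lemma dec_var i : dec (pairn 0 i) = Var i.
Proof. by rewrite decE !unpairE. Qed.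

Lemma dec_meet x y : dec (pairn 1 (pairn x y)) = Meet (dec x) (dec y).
Proof. by rewrite decE !unpairE. Qed.

Lemma dec_join x y : dec (pairn 2 (pairn x y)) = Join (dec x) (dec y).
Proof. by rewrite decE !unpairE. Qed.

Lemma encK : cancel enc dec.
Proof.
by elim=> [i|x IHx y IHy|x IHx y IHy] /=;
  rewrite ?dec_var ?dec_meet ?dec_join ?IHx ?IHy.
Qed.

(** Induction along the decoding of terms. *)
Lemma code_ind (P : nat -> Prop) :
    (forall t, dec t = Var (sndn t) -> P t) ->
    (forall t x y, dec t = Meet (dec x) (dec y) -> x < t -> y < t ->
      P x -> P y -> P t) ->
    (forall t x y, dec t = Join (dec x) (dec y) -> x < t -> y < t ->
      P x -> P y -> P t) ->
  forall t, P t.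
Proof.
move=> Pvar Pmeet Pjoin; elim/ltn_ind => t IHt.
have := decE t; case: (fstn t) (@subcode_lt t) => [_|i []// lt1 lt2].
  exact: Pvar.
by case: i => [|i] decE; [apply: Pmeet decE _ _ _ _ | apply: Pjoin decE _ _ _ _];
  auto.
Qed.

(** The value of a term in a lattice, and its truth value. *)
Fixpoint ti d (D : latticeType d) (h : nat -> D) (t : term) : D :=
  match t with
  | Var i => h i
  | Meet x y => Order.meet (ti h x) (ti h y)
  | Join x y => Order.join (ti h x) (ti h y)
  end.

Fixpoint ev (w : nat -> bool) (t : term) : bool :=
  match t with
  | Var i => w i
  | Meet x y => ev w x && ev w y
  | Join x y => ev w x || ev w y
  end.

Lemma eq_ev (w w' : nat -> bool) t : (forall i, i <= t -> w i = w' i) ->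
  ev w (dec t) = ev w' (dec t).
Proof.
elim/code_ind: t => [t ->|t x y -> ltx lty IHx IHy|t x y -> ltx lty IHx IHy] eq_w /=.
- by apply: eq_w; apply: sndn_le.
- by rewrite IHx ?IHy // => i lei; apply: eq_w; lia.
- by rewrite IHx ?IHy // => i lei; apply: eq_w; lia.
Qed.

Lemma eq_ti d (D : latticeType d) (h h' : nat -> D) t :
  (forall i, i <= t -> h i = h' i) -> ti h (dec t) = ti h' (dec t).
Proof.
elim/code_ind: t => [t ->|t x y -> ltx lty IHx IHy|t x y -> ltx lty IHx IHy] eq_h /=.
- by apply: eq_h; apply: sndn_le.
- by rewrite IHx ?IHy // => i lei; apply: eq_h; lia.
- by rewrite IHx ?IHy // => i lei; apply: eq_h; lia.
Qed.

Lemma ev_mono (w w' : nat -> bool) t : (forall i, w i -> w' i) -> ev w t -> ev w' t.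
Proof.
move=> le_w; elim: t => [i|x IHx y IHy|x IHx y IHy] /=; first exact: le_w.
- by move=> /andP[/IHx -> /IHy].
- by move=> /orP[/IHx ->|/IHy ->] //; rewrite orbT.
Qed.

(** ** Computing truth values *)

Definition eval_step (val : nat -> nat) (t T : nat) : nat :=
  let a := lookup T t (fstn (sndn t)) in
  let b := lookup T t (sndn (sndn t)) in
  ifz (fstn t) (val (sndn t))
    (ifz (fstn t - 1) (ifz a 0 b) (ifz a b 1)).

(** The truth value of the term coded by [t], computed by course-of-values
    recursion from truth values of the variables. *)
Definition evaln (val : nat -> nat) (t : nat) : nat :=
  eval_step val t (table (eval_step val) t).

Lemma evalnE val t : (evaln val t != 0) = ev (fun i => val i != 0) (dec t).
Proof.
elim/ltn_ind: t => t IHt; rewrite decE {1}/evaln {1}/eval_step.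
have foldE i : eval_step val i (table (eval_step val) i) = evaln val i by [].
case: (fstn t) (@subcode_lt t) => [//|i []// lt1 lt2].
rewrite !lookup_table // !foldE.
move: (IHt _ lt1) (IHt _ lt2).
by case: i => [|i] /= <- <-; case: (evaln _ (fstn _)) => // n; case: (evaln _ _).
Qed.

Lemma computable_evaln (val : nat -> nat -> nat) t :
    computable (fun y => val (fstn y) (sndn y)) -> computable t ->
  computable (fun x => evaln (val x) (t x)).
Proof.
move=> cval ct.
have cstep T : computable T -> forall g s, computable g -> computable s ->
    computable (fun x => eval_step (val (g x)) (s x) (T x)).
  move=> cT g s cg cs; rewrite /eval_step.
  have c1 : computable (fun x => lookup (T x) (s x) (fstn (sndn (s x)))).
    by apply: computable_lookup; comp.
  have c2 : computable (fun x => lookup (T x) (s x) (sndn (sndn (s x)))).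
    by apply: computable_lookup; comp.
  have c3 : computable (fun x => val (g x) (sndn (s x))).
    by apply: (computable_app2 cval); comp.
  by comp.
apply: (cstep); [|comp|comp].
apply: (@computable_table (fun x => eval_step (val x))) => //.
by apply: cstep; comp.
Qed.

(** A number codes a truth assignment of names, as a list of values, except that
    the names [0] and [1] stand for the constants false and true. *)
Definition assign (w q : nat) : nat :=
  ifz q 0 (ifz (q - 1) 1 (fstn (iter q (fun x => sndn x) w))).

(** The largest code of a list of [m] truth values. *)
Definition assign_bound (m : nat) : nat := iter m (fun b => pairn 1 b) 0.

Lemma leq_pair2 x x' y y' : x <= x' -> y <= y' -> pairn x y <= pairn x' y'.
Proof.
have := Cantor.to_nat_spec x y; have := Cantor.to_nat_spec x' y'.
by nia.
Qed.

Lemma assign_exists m (w : nat -> bool) : w 0 = false -> w 1 = true ->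
  exists2 a, a <= assign_bound m & forall q, q < m -> (assign a q != 0) = w q.
Proof.
move=> w0 w1.
have [a le_a aE] : exists2 a, a <= assign_bound m &
    forall q, q < m -> fstn (iter q (fun x => sndn x) a) = w q.
  elim: m {w0 w1} w => [|m IHm] w; first by exists 0.
  have [a le_a aE] := IHm (fun q => w q.+1).
  exists (pairn (nat_of_bool (w 0)) a); first by apply: leq_pair2; rewrite ?leq_b1.
  move=> [|q] lt_q; first by rewrite unpairE.
  by rewrite iterSr unpairE aE.
exists a => // -[|[|q]] lt_q; rewrite ?w0 ?w1 //.
by rewrite /assign aE //=; case: (w _).
Qed.

Lemma computable_assign w q : computable w -> computable q ->
  computable (fun x => assign (w x) (q x)).
Proof.
move=> cw cq; rewrite /assign.
have ci : computable (fun x => iter (q x) (fun x => sndn x) (w x)).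
  by apply: (@computable_iter w q (fun _ x => sndn x)); comp.
by comp.
Qed.

Lemma computable_assign_bound m : computable m ->
  computable (fun x => assign_bound (m x)).
Proof.
move=> cm.
by apply: (@computable_iter (fun=> 0) m (fun _ b => pairn 1 b)); comp.
Qed.

(** [good w]: the assignment respects the names of the two constants. *)
Definition good (w : nat -> bool) : Prop := w 0 = false /\ w 1 = true.

(** [entails r r' t s]: the term [t], whose variables are named by [r], entails
    the term [s], whose variables are named by [r']. *)
Definition entails (r r' : nat -> nat) (t s : nat) : Prop :=
  forall w, good w -> ev (w \o r) (dec t) -> ev (w \o r') (dec s).

(** Entailment is c.e. as soon as the names are limits of computable stages
    [p n] and [p' n] in such a way that the final names are obtained from those
    of any stage by one substitution: it then suffices to find a stage at which
    the entailment holds, which can be tested on finitely many assignments. *)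
Lemma ce_entails (p p' : nat -> nat -> nat) (r r' : nat -> nat) :
    computable (fun y => p (fstn y) (sndn y)) ->
    computable (fun y => p' (fstn y) (sndn y)) ->
    (forall n i, p n i <= i + 3) -> (forall n i, p' n i <= i + 3) ->
    (forall n, exists k : nat -> nat, [/\ k 0 = 0, k 1 = 1,
       forall i, r i = k (p n i) & forall i, r' i = k (p' n i)]) ->
    (forall m, exists n, forall i, i < m -> p n i = r i /\ p' n i = r' i) ->
  exists u, forall x, W u x <-> entails r r' (fstn x) (sndn x).
Proof.
move=> cp cp' le_p le_p' subst_r stage_r.
have [|u uP] := @ce_projection (fun x n =>
  bforall (assign_bound (fstn x + sndn x + 4)).+1 (fun w =>
    ifz (evaln (fun i => assign w (p n i)) (fstn x)) 0
      (ifz (evaln (fun i => assign w (p' n i)) (sndn x)) 1 0))).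
  have ceval q t : computable (fun y => q (fstn y) (sndn y)) -> computable t ->
      computable (fun y =>
        evaln (fun i => assign (sndn y) (q (sndn (fstn y)) i)) (t y)).
    move=> cq ct.
    apply: (@computable_evaln
      (fun y i => assign (sndn y) (q (sndn (fstn y)) i))) => //.
    apply: computable_assign; first comp.
    by apply: (computable_app2 cq); comp.
  apply: (@computable_bforall
    (fun y => (assign_bound (fstn (fstn y) + sndn (fstn y) + 4)).+1)
    (fun y w =>
      ifz (evaln (fun i => assign w (p (sndn y) i)) (fstn (fstn y))) 0
        (ifz (evaln (fun i => assign w (p' (sndn y) i)) (sndn (fstn y))) 1 0))).
    by apply: computable_succ; apply: computable_assign_bound; comp.
  apply: computable_ifz; [by apply: (ceval p) => //; comp | by comp |].
  by apply: computable_ifz; [apply: (ceval p') => //; comp | comp | comp].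
exists u => x; rewrite uP; set t := fstn x; set s := sndn x.
split=> [[n /eqP /bforallP all_n] w [w0 w1]|ent].
  have [k [k0 k1 rE r'E]] := subst_r n.
  have [||a le_a aE] := @assign_exists (t + s + 4) (w \o k); rewrite /= ?k0 ?k1 //.
  have := all_n a; rewrite ltnS => /(_ le_a).
  have evE q q' y : y <= t + s -> (forall i, q i = k (q' i)) ->
      (forall i, q' i <= i + 3) ->
      ev (w \o q) (dec y) = (evaln (fun i => assign a (q' i)) y != 0).
    move=> le_y qE le_q'; rewrite evalnE; apply: eq_ev => i le_i.
    by rewrite aE /= ?qE //; have := le_q' i; lia.
  rewrite (evE r (p n)) ?(evE r' (p' n)) //; try lia.
  by case: (evaln _ t) => // m; case: (evaln _ s).
have [n nE] := stage_r (t + s + 1); exists n; apply/eqP/bforallP => a _.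
have := ent (fun q => assign a q != 0) (conj erefl erefl).
have -> : ev ((fun q => assign a q != 0) \o r) (dec t) =
    (evaln (fun i => assign a (p n i)) t != 0).
  by rewrite evalnE; apply: eq_ev => i le_i /=; rewrite (nE i _).1 //; lia.
have -> : ev ((fun q => assign a q != 0) \o r') (dec s) =
    (evaln (fun i => assign a (p' n i)) s != 0).
  by rewrite evalnE; apply: eq_ev => i le_i /=; rewrite (nE i _).2 //; lia.
by case: (evaln _ t) => // m; case: (evaln _ s) => // /(_ isT).
Qed.

(** ** Entailment in bounded distributive lattices *)

(** Shannon expansion: if [h] interpolates between [h0] and [h1] with
    coefficient [x] then so does the value of every term. *)
Lemma ti_shannon d (D : distrLatticeType d) (h h0 h1 : nat -> D) (x : D) t :
    (forall i, (h0 i <= h1 i)%O) ->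
    (forall i, h i = Order.join (h0 i) (Order.meet x (h1 i))) ->
  (ti h0 t <= ti h1 t)%O /\
  ti h t = Order.join (ti h0 t) (Order.meet x (ti h1 t)).
Proof.
move=> le_h hE; elim: t => [i|y [ley yE] z [lez zE]|y [ley yE] z [lez zE]] //=.
  split; first exact: leI2.
  rewrite yE zE.
  set a := ti h0 y in ley *; set b := ti h1 y in ley *.
  set a' := ti h0 z in lez *; set b' := ti h1 z in lez *.
  have e1 : Order.meet a (Order.meet x b') = Order.meet (Order.meet x a) b'.
    by rewrite meetCA meetA.
  apply: le_anti; apply/andP; split.
    rewrite meetUl !meetUr !leUx; apply/andP; split; apply/andP; split.
    - exact: leUl.
    - apply: le_trans (leUr _ _); rewrite !lexI; apply/and3P; split.
      + by rewrite meetCA leIl.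
      + by apply: le_trans ley; rewrite leIl.
      + by rewrite meetA leIr.
    - apply: le_trans (leUr _ _); rewrite !lexI; apply/and3P; split.
      + by rewrite -meetA leIl.
      + by rewrite -meetA leIxr // leIl.
      + by apply: le_trans lez; rewrite leIr.
    - apply: le_trans (leUr _ _); rewrite !lexI; apply/and3P; split.
      + by rewrite -meetA leIl.
      + by rewrite leIxl // leIr.
      + by rewrite leIxr // leIr.
  rewrite leUx; apply/andP; split; first by apply: leI2; exact: leUl.
  by rewrite lexI; apply/andP; split; apply: le_trans (leUr _ _);
    rewrite lexI leIl /= leIxr // ?leIl ?leIr.
split; first exact: leU2.
by rewrite yE zE meetUr joinACA.
Qed.

Lemma ti_bool d (D : tbDistrLatticeType d) (w : nat -> bool) t :
  ti (fun i => if w i then \top else \bot : D)%O t =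
    (if ev w t then \top else \bot)%O.
Proof.
elim: t => [i|x IHx y IHy|x IHx y IHy] //=; rewrite IHx IHy.
- by case: (ev w x); case: (ev w y); rewrite ?meet1x ?meet0x ?meetx0.
- by case: (ev w x); case: (ev w y); rewrite ?join1x ?join0x ?joinx1.
Qed.

(** Entailment is sound in all bounded distributive lattices: the values of the
    variables are replaced by the bounds one after the other. *)
Lemma entails_ti d (D : tbDistrLatticeType d) (r : nat -> nat) t s (h : nat -> D) :
    (forall i, r i <= i + 3) -> entails r r t s ->
    h 0 = \bot%O -> h 1 = \top%O ->
  (ti (h \o r) (dec t) <= ti (h \o r) (dec s))%O.
Proof.
move=> le_r ent.
have bounded n (g : nat -> D) : g 0 = \bot%O -> g 1 = \top%O ->
    (forall j, n <= j -> g j = \bot%O \/ g j = \top%O) ->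
    (ti (g \o r) (dec t) <= ti (g \o r) (dec s))%O.
  elim: n g => [|n IHn] g g0 g1 gE.
    pose w j := if j is j'.+1 then (j' == 0) || (g j == \top%O) else false.
    have -> : g = (fun j => if w j then \top else \bot)%O.
      apply: funext => -[//|[|j]] //=; case: eqP => // gj.
      by case: (gE j.+2 isT).
    rewrite (ti_bool D (w \o r)) (ti_bool D (w \o r)).
    have := ent w (conj erefl erefl).
    by case: (ev _ (dec t)) => [/(_ isT) ->|_]; rewrite ?lexx ?le0x.
  have [le_n1|lt_1n] := leqP n 1.
    apply: IHn => // j; rewrite leq_eqVlt => /predU1P[<-|/gE //].
    by case: n le_n1 {gE} => [|[|n]] //; [left | right].
  pose upd (y : D) j := if j == n then y else g j.
  have updE y : (ti (upd y \o r) (dec t) <= ti (upd y \o r) (dec s))%O \/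
      ~ (y = \bot%O \/ y = \top%O).
    case: (pselect (y = \bot%O \/ y = \top%O)) => yE; last by right.
    left; apply: IHn; rewrite /upd; first by case: eqP => // E; lia.
      by case: eqP => // E; lia.
    by move=> j le_nj; case: eqP => // /eqP ne_jn; apply: gE; lia.
  have expand q : ti (g \o r) q = Order.join (ti (upd \bot%O \o r) q)
      (Order.meet (g n) (ti (upd \top%O \o r) q)).
    apply: (ti_shannon q _ _).2 => i; rewrite /= /upd; case: eqP => [rE|_].
    - exact: le0x.
    - exact: lexx.
    - by rewrite rE join0x meetx1.
    - by rewrite join_l ?leIr.
  rewrite !expand; apply: leU2; last apply: leI2 => //.
    by case: (updE \bot%O) => // -[]; left.
  by case: (updE \top%O) => // -[]; right.
move=> h0 h1.
pose g j := if j < t + s + 4 then h j else \bot%O.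
have gE y : y <= t + s -> ti (h \o r) (dec y) = ti (g \o r) (dec y).
  move=> le_y; apply: eq_ti => i le_i; rewrite /= /g ifT //.
  by have := le_r i; lia.
rewrite !gE; try lia.
apply: (bounded (t + s + 4)); rewrite /g ?addnS //.
by move=> j le_j; left; rewrite ltnNge le_j.
Qed.

(** * The pre-lattice of a naming *)

(** A naming assigns to each variable, in the limit of computable stages, a name:
    [0] for the constant false, [1] for the constant true, and otherwise that of
    a generator. At every stage the names that occur in a given term are bounded
    in terms of its code ([stage_le]), and the final names are obtained from
    those of any stage by a substitution that fixes the constants
    ([name_subst]). The last
    fields provide variables for the constants and infinitely many generators. *)
Record naming := Naming {
  stage : nat -> nat -> nat;
  name : nat -> nat;
  computable_stage : computable (fun y => stage (fstn y) (sndn y));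
  stage_le : forall n i, stage n i <= i + 3;
  name_stage : forall m, exists n, forall i, i < m -> stage n i = name i;
  name_subst : forall n, exists k : nat -> nat,
    [/\ k 0 = 0, k 1 = 1 & forall i, name i = k (stage n i)];
  var0 : nat;
  var1 : nat;
  name_var0 : name var0 = 0;
  name_var1 : name var1 = 1;
  free_var : nat -> nat;
  free_var_inj : injective (name \o free_var);
  name_free_var : forall m, 1 < name (free_var m)
}.

(** An infinite set of numbers has an injective enumeration. *)
Lemma infinite_enum (S : nat -> Prop) (f : nat -> nat) :
    injective f -> (forall m, S (f m)) ->
  exists e : nat -> nat,
    [/\ injective e, forall m, S (e m) & forall q, S q -> exists m, e m = q].
Proof.
move=> f_inj fS.
have infS : infinite_set (S : set nat).
  apply: (@sub_infinite_set _ (f @` setT)%classic) => [_ [m _ <-] //|].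
  rewrite (@eq_finite_set _ _ _ [set: nat]%classic); first exact: infinite_nat.
  by apply: inj_card_eq => ? ? _ _; apply: f_inj.
have /card_esym /card_set_bijP[e [eS e_inj e_surj]]
  := eq_card_nat (@countableP _ _) infS.
exists e; split=> [x y|m|q /e_surj[m _ <-]]; last by exists m.
  by apply: e_inj; rewrite in_setE.
exact: eS.
Qed.

Section Prelattice.
Variable N : naming.
Let r := name N.

Definition meetc (x y : nat) : nat := pairn 1 (pairn x y).
Definition joinc (x y : nat) : nat := pairn 2 (pairn x y).
Definition varc (i : nat) : nat := pairn 0 i.

Lemma name_le i : r i <= i + 3.
Proof.
have [n nE] := name_stage N i.+1.
by rewrite /r -(nE i (ltnSn i)) stage_le.
Qed.

Lemma entails_refl t : entails r r t t. Proof. by []. Qed.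

Lemma entails_trans t s q :
  entails r r t s -> entails r r s q -> entails r r t q.
Proof. by move=> ts sq w gw /(ts _ gw)/(sq _ gw). Qed.

(** The elements are codes of terms, preordered by entailment. *)
Definition pre_structure : preordered_structure :=
  @PreorderedStructure meetc joinc (varc (var0 N)) (varc (var1 N)) (entails r r)
    entails_refl entails_trans.

Lemma ce_ple : ce_rel (ple pre_structure).
Proof.
have [||||n|m|u uP] := @ce_entails (stage N) (stage N) r r.
- exact: computable_stage.
- exact: computable_stage.
- exact: stage_le.
- exact: stage_le.
- by have [k [k0 k1 kE]] := name_subst N n; exists k.
- by have [n nE] := name_stage N m; exists n => i /nE.
by exists u => x y; rewrite uP !unpairE.
Qed.

Lemma pre_peqP x y : peq pre_structure x y <->
  forall w, good w -> ev (w \o r) (dec x) = ev (w \o r) (dec y).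
Proof.
split=> [[xy yx] w gw|eqxy].
  by apply/idP/idP; [apply: xy | apply: yx].
by split=> w gw; rewrite eqxy.
Qed.

Lemma pre_prelattice : is_ce_bounded_prelattice pre_structure.
Proof.
split.
- have [c cP] : computable (fun x => pairn 1 (pairn (fstn x) (sndn x))) by comp.
  by exists c => x y; have := cP (pairn x y); rewrite !unpairE.
- have [c cP] : computable (fun x => pairn 2 (pairn (fstn x) (sndn x))) by comp.
  by exists c => x y; have := cP (pairn x y); rewrite !unpairE.
- exact: ce_ple.
- move=> x x' y y' /pre_peqP xx' /pre_peqP yy'; apply/pre_peqP => w gw.
  by rewrite !dec_meet /= xx' ?yy'.
- move=> x x' y y' /pre_peqP xx' /pre_peqP yy'; apply/pre_peqP => w gw.
  by rewrite !dec_join /= xx' ?yy'.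
- move=> x y Z; rewrite -[Z]reprK -!/(class _ _) !le_class -asbool_and.
  apply/asbool_equiv_eq; split=> [ent|[entx enty] w gw tZ].
    by split=> w gw /(ent _ gw); rewrite dec_meet => /andP[].
  by rewrite dec_meet /= entx ?enty.
- move=> x y Z; rewrite -[Z]reprK -!/(class _ _) !le_class -asbool_and.
  apply/asbool_equiv_eq; split=> [ent|[entx enty] w gw].
    by split=> w gw tx; apply: ent => //; rewrite dec_join /= tx ?orbT.
  by rewrite dec_join /= => /orP[/entx|/enty]; apply.
- move=> Z; rewrite -[Z]reprK -!/(class _ _) le_class; apply/asboolP => w [w0 _].
  by rewrite dec_var /= /r name_var0 w0.
- move=> Z; rewrite -[Z]reprK -!/(class _ _) le_class; apply/asboolP => w [_ w1].
  by rewrite dec_var /= /r name_var1 w1.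
Qed.

Definition prelattice : ce_bounded_prelattice := CEBoundedPrelattice pre_prelattice.

Notation L := prelattice.

Lemma classE (X : quot L) : exists x, X = class L x.
Proof. by exists (repr X); rewrite /class reprK. Qed.

Lemma class_peqP x y : class L x = class L y <->
  forall w, good w -> ev (w \o r) (dec x) = ev (w \o r) (dec y).
Proof. by rewrite classP; apply: pre_peqP. Qed.

Lemma class_dec x y : dec x = dec y -> class L x = class L y.
Proof. by move=> eq_xy; apply/class_peqP => w gw; rewrite eq_xy. Qed.

(** Variables are equivalent exactly when they have the same name: an assignment
    making at most one generator true separates different names. *)
Lemma class_var_eq i j : class L (varc i) = class L (varc j) <-> r i = r j.
Proof.
rewrite class_peqP !dec_var /=; split=> [eq_w|-> //].
pose w p q := (q == 1) || (q == p) && (p != 0).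
have gw p : good (w p) by split; rewrite /w //=; case: eqP => // <-.
have := eq_w _ (gw (r i)); have := eq_w _ (gw (r j)).
by rewrite /w !eqxx /=; case: (r i) (r j) => [|[|a]] [|[|b]] //=;
  rewrite !andbT => /eqP.
Qed.

Lemma prelattice_distributive : distributive_prelattice L.
Proof.
move=> X Y Z; have [x ->] := classE X; have [y ->] := classE Y.
have [z ->] := classE Z; rewrite -class_join -!class_meet -class_join.
by apply/class_peqP => w gw; rewrite !(dec_join, dec_meet) /= andb_orl.
Qed.

(** The classes of the variables with names above [1] are free generators. *)
Lemma prelattice_free : free_on_countably_many L.
Proof.
split; first exact: prelattice_distributive.
have [|m|e [e_inj eS e_surj]] := @infinite_enum
    (fun q => 1 < q /\ exists i, r i = q) (r \o free_var N).
- exact: free_var_inj.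
- by split; [exact: name_free_var | exists (free_var N m)].
have [v vE] := choice (fun m => (eS m).2).
exists (fun m => class L (varc (v m))); split.
  by move=> m m' /class_var_eq; rewrite !vE => /e_inj.
move=> d D h.
have [g gE] : exists g : nat -> D,
    [/\ g 0 = \bot%O, g 1 = \top%O & forall m, g (e m) = h m].
  have inv q : exists y : D, [/\ q = 0 -> y = \bot%O, q = 1 -> y = \top%O &
      forall m, e m = q -> y = h m].
    case: q => [|[|q]].
    - by exists \bot%O; split=> // m em; have := (eS m).1; rewrite em.
    - by exists \top%O; split=> // m em; have := (eS m).1; rewrite em.
    - case: (pselect (exists m, e m = q.+2)) => [[m em]|ne].
        by exists (h m); split=> // m'; rewrite -em => /e_inj ->.
      by exists \bot%O; split=> // m em; case: ne; exists m.
  have [g gP] := choice inv; exists g.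
  by split=> [||m]; [case: (gP 0) => + _ _ | case: (gP 1) => _ + _ | 
    case: (gP (e m)) => _ _ +]; apply.
case: gE => g0 g1 ge.
pose f (X : quot L) : D := ti (g \o r) (dec (repr X)).
have fE x : f (class L x) = ti (g \o r) (dec x).
  have [xr rx] := peq_repr L x.
  by apply: le_anti; apply/andP; split; apply: entails_ti => //; apply: name_le.
exists f; split.
  split; last by apply: funext => m /=; rewrite fE dec_var /= vE ge.
  split=> [X Y|X Y||].
  - have [x ->] := classE X; have [y ->] := classE Y.
    by rewrite -class_meet !fE dec_meet.
  - have [x ->] := classE X; have [y ->] := classE Y.
    by rewrite -class_join !fE dec_join.
  - by rewrite -class_zero fE dec_var /= /r name_var0.
  - by rewrite -class_one fE dec_var /= /r name_var1.
move=> f' [[f'I f'U f'0 f'1] f'h]; apply: funext => X.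
have [x ->] := classE X; rewrite fE.
rewrite -(class_dec (encK (dec x))).
elim: (dec x) => [i|a IHa b IHb|a IHa b IHb] /=.
- have [ri0|ri_gt0] := posnP (r i).
    rewrite ri0 g0 -f'0 -class_zero; congr f'; apply/class_var_eq.
    by rewrite ri0 /r name_var0.
  have [ri1|ri_ne1] := eqVneq (r i) 1.
    rewrite ri1 g1 -f'1 -class_one; congr f'; apply/class_var_eq.
    by rewrite ri1 /r name_var1.
  have [|m em] := e_surj (r i); first by split; [lia | exists i].
  rewrite -em ge -f'h /=; congr f'; apply/class_var_eq.
  by rewrite vE em.
- by rewrite IHa IHb -f'I; congr f'; exact/esym/class_meet.
- by rewrite IHa IHb -f'U; congr f'; exact/esym/class_join.
Qed.

(** Effective inseparability is inherited from the pair [(raceA, raceB)] along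
    any computable map that names the first set false and the second true. *)
Lemma prelattice_ei (f : nat -> nat) : computable f ->
    (forall z, raceA z -> r (f z) = 0) -> (forall z, raceB z -> r (f z) = 1) ->
  ei_prelattice L.
Proof.
move=> cf fA fB; split.
  apply/seteqP; split=> // x /= [x0 x1].
  suff : class L (varc (var0 N)) = class L (varc (var1 N)).
    by move=> /class_var_eq; rewrite /r name_var0 name_var1.
  have /classP <- := x0; exact/classP.
have cvf : computable (fun z => varc (f z)) by rewrite /varc; comp.
have [c cP] := cvf.
pose pre u := pairn 5 (pairn u (encode c)).
have preP u z : W (pre u) z <-> W u (varc (f z)).
  rewrite /W /= decodeE /pre !unpairE encodeK /=.
  split=> [[y [x cz dy]]|[y dy]]; first by exists y; rewrite (eval_inj (cP z) cz).
  by exists y, (varc (f z)).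
pose phi u v := varc (f (pairn (pre u) (pre v))).
exists (fun u v => Some (phi u v)).
  have [c' c'P] : computable (fun y => phi (fstn y) (sndn y)).
    by apply: (computable_comp cvf); rewrite /pre; comp.
  exists c' => u v z; have := c'P (pairn u v); rewrite !unpairE => ev_phi.
  by split=> [[<-] //|/(eval_inj ev_phi) ->].
move=> u v sAu sBv uv0; exists (phi u v) => // Wphi.
apply: (@race_ei (pre u) (pre v)) => [z Az|z Bz|z /preP Wu /preP Wv|].
- apply/preP/sAu => /=; apply/classP/class_var_eq.
  by rewrite fA // /r name_var0.
- apply/preP/sBv => /=; apply/classP/class_var_eq.
  by rewrite fB // /r name_var1.
- suff : (set0 (varc (f z)))%classic by [].
  by rewrite -uv0.
- by case: Wphi => Wphi; [left | right]; apply/preP.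
Qed.

End Prelattice.

(** * Irreducible elements *)

(** Irreducible both for meets and for joins; the bounds are not excluded. *)
Definition irreducible (L : ce_bounded_prelattice) (X : quot L) : Prop :=
  forall Y Z : quot L,
    (X = Order.meet Y Z -> X = Y \/ X = Z) /\
    (X = Order.join Y Z -> X = Y \/ X = Z).

Lemma irreducible_iso (L L' : ce_bounded_prelattice) (F : quot L -> quot L') X :
  bijective F -> bounded_lattice_morphism F -> irreducible X -> irreducible (F X).
Proof.
move=> [G FK GK] [FI FU _ _] irrX Y Z; rewrite -(GK Y) -(GK Z) -FI -FU.
have [irrI irrU] := irrX (G Y) (G Z).
by split=> /(can_inj FK) XE; [case: irrI | case: irrU] => // <-; auto.
Qed.

(** An irreducible term is equivalent to one of its variables. *)
Lemma irreducible_var N x : irreducible (class (prelattice N) x) ->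
  exists i, class (prelattice N) x = class (prelattice N) (varc i).
Proof.
rewrite -(class_dec N (encK (dec x))).
elim: (dec x) => [i|a IHa b IHb|a IHa b IHb] irr; first by exists i.
- have [/(_ (class_meet (prelattice N) (enc a) (enc b))) irrE _] :=
    irr (class _ (enc a)) (class _ (enc b)).
  by case: irrE irr => /= ->; [apply: IHa | apply: IHb].
- have [_ /(_ (class_join (prelattice N) (enc a) (enc b))) irrE] :=
    irr (class _ (enc a)) (class _ (enc b)).
  by case: irrE irr => /= ->; [apply: IHa | apply: IHb].
Qed.

(** A generator is irreducible: a term lies below it as soon as it is false
    under the largest assignment that makes the generator false, and that
    assignment falsifies one of the factors of a meet equal to the generator.
    The argument for joins is dual. *)
Lemma var_irreducible N i : 1 < name N i ->
  irreducible (class (prelattice N) (varc i)).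
Proof.
set p := name N i => p_gt1 Y Z.
have [y ->] := classE Y; have [z ->] := classE Z.
rewrite -class_meet -class_join !class_peqP dec_meet dec_join dec_var /=.
rewrite -/p; split=> eq_w.
  pose wmax q := (q != 0) && (q != p).
  have gwmax : good wmax by split; rewrite /wmax //=; case: eqP p_gt1 => // <-.
  have below x : ~~ ev (wmax \o name N) (dec x) ->
      forall w, good w -> ev (w \o name N) (dec x) -> w p.
    move=> /negP xmax w [w0 _] wx; apply: contraT => wp; case: xmax.
    apply: ev_mono wx => j /= wj; rewrite /wmax.
    by apply/andP; split; apply/eqP => E; move: wj wp; rewrite E ?w0 // => ->.
  have := eq_w _ gwmax; rewrite {1}/wmax eqxx andbF => /esym/negbT.
  rewrite negb_and => /orP[/below le_x|/below le_x]; [left | right] => w gw;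
    (apply/idP/idP; [by rewrite (eq_w _ gw) => /andP[] | exact: le_x]).
pose wmin q := (q == 1) || (q == p).
have gwmin : good wmin by split; rewrite /wmin //=; case: eqP p_gt1 => // <-.
have above x : ev (wmin \o name N) (dec x) ->
    forall w, good w -> w p -> ev (w \o name N) (dec x).
  move=> xmin w [_ w1] wp; apply: ev_mono xmin => j /=.
  by rewrite /wmin => /orP[] /eqP ->.
have := eq_w _ gwmin; rewrite {1}/wmin eqxx orbT => /esym.
move=> /orP[/above le_x|/above le_x]; [left | right] => w gw;
  (apply/idP/idP; [exact: le_x | by rewrite (eq_w _ gw) => ->; rewrite ?orbT]).
Qed.

(** * The two lattices *)

(** The variables [<0, z>] encode the inseparable pair, [<2, z>] and [<3, z>] are
    constants, and the others are generators, except that, if [c] holds, all the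
    [<1, z>] with [z] in [raceA] are identified under the name [2]. *)
Definition race_stage (c : bool) (n i : nat) : nat :=
  let st := race (sndn i) n in
  ifz (fstn i) (ifz st (i + 3) (st - 1))
  (ifz (fstn i - 1) (ifz (distn st 1) (if c then 2 else i + 3) (i + 3))
  (ifz (fstn i - 2) 0 (ifz (fstn i - 3) 1 (i + 3)))).

Lemma computable_race_stage c :
  computable (fun y => race_stage c (fstn y) (sndn y)).
Proof.
have cr : computable (fun y => race (sndn (sndn y)) (fstn y)).
  by apply: (computable_app2 computable_race); comp.
by rewrite /race_stage; case: c; comp.
Qed.

(** A stage only changes default names, and sets them once and for all. *)
Lemma race_stageP c n i : race_stage c n i = i + 3 \/
  race_stage c n i <= 2 /\ forall m, n <= m -> race_stage c m i = race_stage c n i.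
Proof.
rewrite /race_stage; case: (fstn i) => [|[|[|[|k]]]] /=; auto.
- have := @race_stable (sndn i) n; case: (race_outcome (sndn i) n) => [->|[->]|[->]];
    first by left.
  + by move=> _ st; right; split=> // m /(st _ isT) ->.
  + by move=> _ st; right; split=> // m /(st _ isT) ->.
- have := @race_stable (sndn i) n; case: (race_outcome (sndn i) n) => [->|[->]|[->]];
    try by left.
  move=> _ st; case: c; last by left.
  by right; split=> // m /(st _ isT) ->.
Qed.

(** The limit of the stages. *)
Definition race_name (c : bool) (i : nat) : nat :=
  xget 0 [set q | exists n, forall m, n <= m -> race_stage c m i = q]%classic.

Lemma race_name_eq c i n q :
  (forall m, n <= m -> race_stage c m i = q) -> race_name c i = q.
Proof.
move=> nq; have [n' n'P] := xgetI 0 (ex_intro _ n nq :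
  [set q | exists n, forall m, n <= m -> race_stage c m i = q]%classic q).
exact: etrans (esym (n'P _ (leq_maxr n n'))) (nq _ (leq_maxl n n')).
Qed.

Lemma race_name_limit c i :
  exists n, forall m, n <= m -> race_stage c m i = race_name c i.
Proof.
suff [q [n nq]] : exists q n, forall m, n <= m -> race_stage c m i = q.
  by exists n => m /nq ->; apply/esym/race_name_eq/nq.
case: (pselect (exists n, race_stage c n i <> i + 3)) => [[n ni]|nex].
  by exists (race_stage c n i), n => m; case: (race_stageP c n i) => // -[_]; apply.
exists (i + 3), 0 => m _; apply: contra_notP nex => mi; by exists m.
Qed.

Lemma race_name_stage c m : exists n, forall i, i < m ->
  race_stage c n i = race_name c i.
Proof.
suff [n nP] : exists n, forall i k, i < m -> n <= k ->
    race_stage c k i = race_name c i by exists n => i /nP; apply.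
elim: m => [|m [n nP]]; first by exists 0.
have [n' n'P] := race_name_limit c m; exists (maxn n n') => i k.
rewrite geq_max ltnS leq_eqVlt => /predU1P[->|lt_im] /andP[le_nk le_n'k].
  exact: n'P.
exact: nP.
Qed.

Lemma race_name_subst c n : exists k : nat -> nat,
  [/\ k 0 = 0, k 1 = 1 & forall i, race_name c i = k (race_stage c n i)].
Proof.
exists (fun q => if q is i.+3 then race_name c i else q); split=> // i.
case: (race_stageP c n i) => [->|[le2 st]]; first by rewrite addn3.
rewrite (race_name_eq st).
by case: (race_stage c n i) le2 => [|[|[|]]].
Qed.

Lemma race_stage_le c n i : race_stage c n i <= i + 3.
Proof. by case: (race_stageP c n i) => [->|[le2 _]] //; lia. Qed.

Lemma race_name0 c z : race_name c (pairn 2 z) = 0.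
Proof. by apply: (@race_name_eq _ _ 0) => m _; rewrite /race_stage !unpairE. Qed.

Lemma race_name1 c z : race_name c (pairn 3 z) = 1.
Proof. by apply: (@race_name_eq _ _ 0) => m _; rewrite /race_stage !unpairE. Qed.

Lemma race_name_free c z : race_name c (pairn 4 z) = pairn 4 z + 3.
Proof. by apply: (@race_name_eq _ _ 0) => m _; rewrite /race_stage !unpairE. Qed.

Lemma pairn_inj x : injective (fun y => pairn x y).
Proof. by move=> y y' E; rewrite -(sndn_pair x y) E sndn_pair. Qed.

Lemma race_free_inj c : injective (race_name c \o (fun z => pairn 4 z)).
Proof. by move=> z z' /=; rewrite !race_name_free => /addIn/pairn_inj. Qed.

Lemma race_free_gt1 c z : 1 < race_name c (pairn 4 z).
Proof. by rewrite race_name_free; lia. Qed.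

Definition race_naming (c : bool) : naming :=
  Naming (computable_race_stage c) (race_stage_le c) (race_name_stage c)
    (race_name_subst c) (race_name0 c 0) (race_name1 c 0)
    (@race_free_inj c) (race_free_gt1 c).

Lemma race_nameA c z : raceA z -> race_name c (pairn 0 z) = 0.
Proof.
move=> [n rn]; apply: (@race_name_eq _ _ n) => m le_nm.
by rewrite /race_stage !unpairE /= (race_stable _ le_nm) rn.
Qed.

Lemma race_nameB c z : raceB z -> race_name c (pairn 0 z) = 1.
Proof.
move=> [n rn]; apply: (@race_name_eq _ _ n) => m le_nm.
by rewrite /race_stage !unpairE /= (race_stable _ le_nm) rn.
Qed.

Lemma race_name_merged z : raceA z -> race_name true (pairn 1 z) = 2.
Proof.
move=> [n rn]; apply: (@race_name_eq _ _ n) => m le_nm.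
by rewrite /race_stage !unpairE /= (race_stable _ le_nm) rn.
Qed.

Lemma race_name_unmerged c z : ~ raceA z ->
  race_name c (pairn 1 z) = pairn 1 z + 3.
Proof.
move=> nAz; apply: (@race_name_eq _ _ 0) => m _.
rewrite /race_stage !unpairE /= ifz_eq.
by case: eqP => // rm; case: nAz; exists m.
Qed.

(** Without merging, a generator is the class of a single variable. *)
Lemma race_name_false i : race_name false i <= 1 \/ race_name false i = i + 3.
Proof.
have [n /(_ n (leqnn n)) <-] := race_name_limit false i.
rewrite /race_stage; case: (fstn i) => [|[|[|[|k]]]] /=; auto.
- by case: (race_outcome (sndn i) n) => [->|[-> _]|[-> _]]; auto.
- by rewrite ifz_eq if_same; right.
Qed.

Lemma ei_race c : ei_prelattice (prelattice (race_naming c)).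
Proof.
apply: (@prelattice_ei _ (fun z => pairn 0 z)); first comp.
- exact: race_nameA.
- exact: race_nameB.
Qed.

(** In the unmerged lattice, the terms equivalent to a variable other than the
    generator [k] are effectively recognised by their independence of [k]:
    making [k] true does not make them true when making [k] false does not. *)
Lemma ce_independent k : race_name false k = k + 3 -> exists u, forall t,
  (exists j, class (prelattice (race_naming false)) t =
             class (prelattice (race_naming false)) (varc j)) ->
  W u t <-> class (prelattice (race_naming false)) t <>
            class (prelattice (race_naming false)) (varc k).
Proof.
move=> rk; set r := race_name false.
pose fix_stage (b n i : nat) := ifz (distn i k) b (race_stage false n i).
pose fix_name (b i : nat) := ifz (distn i k) b (r i).
have cfix b : computable (fun y => fix_stage b (fstn y) (sndn y)).
  have cs := computable_race_stage false.
  by rewrite /fix_stage; comp.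
have le_fix b n i : b <= 1 -> fix_stage b n i <= i + 3.
  move=> le_b; rewrite /fix_stage ifz_eq; case: eqP => _; first lia.
  exact: race_stage_le.
have [||||n|m|u uP] :=
  @ce_entails (fix_stage 1) (fix_stage 0) (fix_name 1) (fix_name 0).
- exact: cfix.
- exact: cfix.
- by move=> n i; apply: le_fix.
- by move=> n i; apply: le_fix.
- have [s [s0 s1 sE]] := race_name_subst false n; exists s; split=> // i;
    by rewrite /fix_name /fix_stage !ifz_eq; case: eqP => // _; rewrite ?s0 ?s1 -?sE.
- have [n nE] := race_name_stage false m; exists n => i /nE iE.
  by rewrite /fix_name /fix_stage iE.
have [v vP] := @ce_preimage u (fun t => pairn t t) ltac:(comp).
exists v => t [j tj]; rewrite vP uP !unpairE tj class_var_eq /= -/r.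
have tw : forall w b, good w -> b <= 1 ->
    ev (w \o fix_name b) (dec t) =
    if r j == k + 3 then b == 1 else w (r j).
  move=> w b [w0 w1] le_b.
  pose wb q := if q == k + 3 then b == 1 else w q.
  have -> : w \o fix_name b = wb \o r.
    apply: funext => i; rewrite /= /fix_name /wb ifz_eq.
    case: eqP => [->|ne_ik].
      by rewrite /r rk eqxx; case: b le_b {wb} => [|[|]].
    case: eqP => // ri; case: (race_name_false i); rewrite -/r ri; lia.
  have gwb : good wb by split; rewrite /wb ifF ?w0 ?w1 //; apply/eqP; lia.
  by have /class_peqP/(_ _ gwb) := tj; rewrite dec_var.
rewrite /r rk; split=> [ent rj|ne_rj w gw]; last first.
  by rewrite !tw //; case: eqP.
have gw : good (fun q => q == 1) by [].
by have := ent _ gw; rewrite !tw // /r rj eqxx => /(_ isT).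
Qed.

Lemma not_isomorphic : ~ computably_isomorphic
  (prelattice (race_naming true)) (prelattice (race_naming false)).
Proof.
set L := prelattice _; set L' := prelattice _.
move=> [f [cf f_le [F [FE Fbij Fmor]]]].
pose s z := varc (pairn 1 z).
have irr_s z : irreducible (class L (s z)).
  apply: var_irreducible => /=.
  case: (pselect (raceA z)) => Az; first by rewrite race_name_merged.
  by rewrite race_name_unmerged //; lia.
have var_fs z : exists j, class L' (f (s z)) = class L' (varc j).
  by apply: irreducible_var; rewrite -FE; apply: irreducible_iso.
have [a Aa] : exists a, raceA a.
  apply: contrapT => nA; apply: (@raceA_not_coce (encode Zero)) => z.
  rewrite W_encode; split=> [_ Az|_]; first by apply: nA; exists z.
  by exists 0.
have [k fsak] := var_fs a.
have rk : race_name false k = k + 3.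
  case: (race_name_false k) => // rk.
  have ne_bound i : race_name true i <= 1 -> class L (s a) <> class L (varc i).
    move=> le1 /class_var_eq /=; rewrite race_name_merged // => E.
    by rewrite -E in le1.
  have Finj := bij_inj Fbij; case: Fmor => _ _ F0 F1.
  case E: (race_name false k) rk => [|[|]] // _.
  - case: (ne_bound (var0 (race_naming true))); first by rewrite /= race_name0.
    apply: Finj; rewrite FE fsak; apply: etrans (esym F0).
    by apply/class_var_eq; rewrite /= race_name0.
  - case: (ne_bound (var1 (race_naming true))); first by rewrite /= race_name1.
    apply: Finj; rewrite FE fsak; apply: etrans (esym F1).
    by apply/class_var_eq; rewrite /= race_name1.
have [u uP] := ce_independent rk.
have [v vP] : exists v, forall z, W v z <-> W u (f (s z)).
  apply: ce_preimage; apply: (computable_comp cf); rewrite /s /varc; comp.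
apply: (@raceA_not_coce v) => z; rewrite vP uP; last exact: var_fs.
rewrite -fsak -!FE; split=> [ne Az|nAz E].
  by apply: ne; congr F; apply/class_var_eq; rewrite /= !race_name_merged.
have /class_var_eq /= := bij_inj Fbij E.
by rewrite race_name_unmerged // race_name_merged //; lia.
Qed.

Theorem theorem59 :
  exists L1 L2 : ce_bounded_prelattice,
    (ei_prelattice L1 /\ ei_prelattice L2) /\
    (distributive_prelattice L1 /\ distributive_prelattice L2) /\
    (free_on_countably_many L1 /\ free_on_countably_many L2) /\
    ~ computably_isomorphic L1 L2.
Proof.
exists (prelattice (race_naming true)), (prelattice (race_naming false)).
split; first by split; apply: ei_race.
split; first by split; apply: prelattice_distributive.
split; first by split; apply: prelattice_free.
exact: not_isomorphic.
Qed.
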